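(* Let $\eta$ be the unique number in the interval $(1,2]$ that satisfies the equation $$\left(\frac{2^{\eta}}{2^{\eta}-1}\right)\left(\frac{3^{\eta}+1}{3^{\eta}-1}\right)=\zeta(\eta).$$ If $r\in(1,\infty)$, then the range of the function $\sigma_{-r}$ is dense in the interval $[1,\zeta(r))$ if and only if $r\leq\eta$.
   Context: $\mathbb{N}$ denotes the set of positive integers and $\zeta$ denotes the Riemann zeta function. For a real number $t$, the function $\sigma_t\colon\mathbb{N}\to\mathbb{R}$ is defined by $\sigma_t(n)=\sum_{d\mid n,\ d>0}d^{t}$ for all $n\in\mathbb{N}$; thus $\sigma_{-r}(n)=\sum_{d\mid n,\ d>0}d^{-r}$. The range of $\sigma_{-r}$ is the set $\{\sigma_{-r}(n):n\in\mathbb{N}\}$, which for $r>1$ is a subset of $[1,\zeta(r))$. *)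

(* Defs.v *)
From mathcomp Require Import all_boot all_order all_algebra.
From mathcomp Require Import all_classical all_reals all_analysis.

Set Implicit Arguments.
Unset Strict Implicit.
Unset Printing Implicit Defensive.

Import Order.TTheory GRing.Theory Num.Theory.
Import numFieldNormedType.Exports.

Local Open Scope classical_set_scope.
Local Open Scope ring_scope.

(* [riemannR s n] is (n + 1)^-s, so this is the sum of n^-s over n >= 1.
   The series converges, and the value is meaningful, only for 1 < s. *)
Definition zeta (R : realType) (s : R) : R := limn (series (riemannR s)).

Definition sigma (R : realType) (t : R) (n : nat) : R :=
  \sum_(d <- divisors n) d%:R `^ t.

(* The domain of sigma is the set of positive integers. *)
Definition sigma_range (R : realType) (t : R) : set R :=
  [set sigma t n | n in [set n : nat | (0 < n)%N]].

(* The library's [dense] is density in the whole space. *)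
Definition dense_in (T : topologicalType) (A X : set T) : Prop :=
  X `<=` closure A.

Definition eta_equation (R : realType) (s : R) : Prop :=
  (2 `^ s / (2 `^ s - 1)) * ((3 `^ s + 1) / (3 `^ s - 1)) = zeta s.

(* Main.v *)
(* For a prime p let T_p(r) be the product of (1 - q^-r)^-1 over the primes q > p.
   The range of sigma_{-r} is dense iff 1 + p^-r <= T_p(r) for every prime p.  If
   this holds, a greedy choice of the exponents of 2, 3, 5, ... approximates any
   point of [1, zeta(r)); if it fails at p, there is a gap between T_p(r) and
   1 + p^-r, since n either has only prime factors > p or a prime factor <= p.

   Let r <= 2.  For p >= 5 the inequality follows from the existence of primes
   q > p with sum (p/q)^2 >= 1: Chebyshev's bound on binomial(2n, n) gives enough
   of them for p >= 4096, and explicit primes do below.  The case p = 2 follows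
   from the case p = 3.  So only p = 3 matters, where equality is the equation
   defining eta.  Now 3^r (T_3(r) - 1) is the sum of (3/n)^r over n > 1 coprime to
   6, which is strictly decreasing in r; it is at least 1 at r = 3/2 and at most 1
   at r = 2, which yields existence and uniqueness of eta and the equivalence. *)
Require Import Defs.
From mathcomp Require Import all_boot all_order all_algebra.
From mathcomp Require Import all_classical all_reals all_analysis.
From mathcomp Require Import ring lra zify.

Import Order.TTheory GRing.Theory Num.Theory.
Import numFieldNormedType.Exports.

Set Implicit Arguments.
Unset Strict Implicit.
Unset Printing Implicit Defensive.

(** * Primes beyond a given prime *)

Lemma leq_divnD_add1 m n d : (0 < d -> (m + n) %/ d <= m %/ d + n %/ d + 1)%N.
Proof. by move=> d0; rewrite divnD// leq_add2l leq_b1. Qed.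

(** By Legendre's formula the exponent is a sum over [k] of terms that are at most 1 and vanish once
    [p ^ k] exceeds [n]. *)
Lemma logn_bin_le p n m : prime p -> (m <= n)%N ->
  (logn p 'C(n, m) <= trunc_log p n)%N.
Proof.
move=> pr mn; have p1 := prime_gt1 pr.
case: (posnP n) mn => [->|n0] mn; first by move: mn; case: m => // _; rewrite bin0 logn1.
have e : logn p n`! = (logn p 'C(n, m) + (logn p m`! + logn p (n - m)`!))%N.
  by rewrite -(bin_fact mn) !lognM ?muln_gt0 ?fact_gt0// bin_gt0.
have fE q : (q <= n)%N -> logn p q`! = (\sum_(1 <= k < n.+1) q %/ p ^ k)%N.
  move=> qn; rewrite logn_fact// [RHS](@big_cat_nat _ _ _ (q.+1))//=.
  rewrite [X in (_ + X)%N]big_nat_cond [X in (_ + X)%N]big1 ?addn0// => i /andP[/andP[qi _] _].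
  by rewrite divn_small// (leq_trans qi)// ltnW// ltn_expl.
move: e; rewrite !fE ?leq_subr// -big_split/= => e.
rewrite -(leq_add2r (\sum_(1 <= k < n.+1) (m %/ p ^ k + (n - m) %/ p ^ k))) -e.
have -> : trunc_log p n = (\sum_(1 <= k < n.+1) (k <= trunc_log p n))%N.
  rewrite (@big_cat_nat _ _ _ (trunc_log p n).+1)//=; last first.
    by rewrite ltnS (leq_trans (ltnW (ltn_expl _ p1)))// trunc_logP.
  rewrite [X in (_ + X)%N]big_nat_cond [X in (_ + X)%N]big1 ?addn0; last first.
    by move=> i /andP[/andP[qi _] _]; rewrite leqNgt qi.
  rewrite big_nat_cond (eq_bigr (fun=> 1%N)).
    by rewrite -big_nat_cond sum_nat_const_nat subn1 muln1.
  by move=> i /andP[/andP[_]]; rewrite ltnS => ->.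
rewrite -big_split/=; apply: leq_sum => k _.
have [kt|tk] := leqP k (trunc_log p n); last first.
  rewrite divn_small//; apply: contraTT tk; rewrite -!leqNgt => pn.
  exact: trunc_log_max.
have := @leq_divnD_add1 m (n - m) (p ^ k).
by rewrite expn_gt0 prime_gt0// subnKC// => /(_ isT); lia.
Qed.

(** Each prime contributes a power that is at most [n], and only primes up to [n] occur. *)
Lemma bin_le_expn_pi n m : (m <= n)%N ->
  ('C(n, m) <= n ^ count prime (iota 0 n.+1))%N.
Proof.
move=> mn; case: (posnP n) mn => [->|n0] mn; first by move: mn; case: m.
have b0 : (0 < 'C(n, m))%N by rewrite bin_gt0.
rewrite -{1}(partn_pi b0) /partn.
have -> : (\prod_(0 <= p < 'C(n, m).+1 | p \in \pi('C(n, m))) p ^ logn p 'C(n, m) =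
  \prod_(p <- primes 'C(n, m)) p ^ logn p 'C(n, m))%N.
  rewrite -big_filter; apply/perm_big/uniq_perm; rewrite ?filter_uniq ?iota_uniq ?primes_uniq//.
  move=> p; rewrite mem_filter mem_index_iota /= ltnS andb_idr//.
  by rewrite inE/= mem_primes => /and3P[_ _ /dvdn_leq]; exact.
have sub : {subset primes 'C(n, m) <= [seq p <- iota 0 n.+1 | prime p]}.
  move=> p; rewrite mem_primes mem_filter mem_iota add0n ltnS => /and3P[pr _ pd].
  rewrite pr/= leqNgt; apply/negP => np.
  have : (0 < logn p 'C(n, m))%N by rewrite logn_gt0 mem_primes pr b0.
  have := logn_bin_le pr mn.
  suff /eqP -> : trunc_log p n == 0%N by rewrite leqn0 => /eqP ->.
  by rewrite trunc_log_eq0; apply/orP; right; lia.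
apply: (@leq_trans (\prod_(p <- primes 'C(n, m)) n)%N).
  rewrite big_seq_cond [leqRHS]big_seq_cond; apply: leq_prod => p.
  rewrite mem_primes => /andP[/and3P[pr _ _] _].
  apply: leq_trans (trunc_logP (prime_gt1 pr) n0).
  by rewrite leq_exp2l ?prime_gt1//; exact: logn_bin_le.
rewrite big_const_seq count_predT iter_muln_1 leq_pexp2l//.
by rewrite -size_filter uniq_leq_size// primes_uniq.
Qed.


(** Since (n + 1) C(2n + 2, n + 1) = 2 (2n + 1) C(2n, n), the right-hand side at least quadruples at
    each step. *)
Lemma central_bin_ge n : (0 < n)%N -> (4 ^ n <= n.*2 * 'C(n.*2, n))%N.
Proof.
case: n => // n _; elim: n => [//|n IHn].
have e1 := mul_bin_diag n.+2.*2 n.+1; have e2 := mul_bin_down n.+1.*2.+1 n.+1.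
rewrite (_ : n.+2.*2.-1 = n.+1.*2.+1)// in e1.
rewrite (_ : n.+1.*2.+1.-1 = n.+1.*2)// (_ : n.+1.*2.+1 - n.+1 = n.+2)%N in e2; last lia.
rewrite expnS; move: IHn e1 e2.
move: 'C(n.+2.*2, n.+2) 'C(n.+1.*2.+1, n.+1) 'C(n.+1.*2, n.+1) => c b a IHn e1 e2.
have : (c * (n.+2 * n.+2) = n.+2.*2 * (n.+1.*2.+1 * a))%N.
  by rewrite e2 mulnA (mulnC c) -e1 -mulnA (mulnC b).
move: (4 ^ n.+1)%N IHn => q IHn.
nia.
Qed.

(** Chebyshev's lower bound; at powers of 2 it reduces to comparing exponents of 2, with no
    logarithm. *)
Lemma pow2_le_count_prime k : (0 < k)%N ->
  (2 ^ k <= k * (count prime (iota 0 (2 ^ k).+1)).+1)%N.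
Proof.
case: k => // k _; set c := count _ _.
have k0 : (0 < 2 ^ k)%N by rewrite expn_gt0.
have kE : (2 ^ k).*2 = (2 ^ k.+1)%N by rewrite expnS mul2n.
have := central_bin_ge k0; rewrite kE => h.
have := @bin_le_expn_pi (2 ^ k.+1) (2 ^ k); rewrite leq_exp2l// leqnSn => /(_ isT) h2.
have := leq_trans h (leq_mul (leqnn _) h2).
by rewrite -/c -expnS -expnM -(expnM 2 2) leq_exp2l// -expnS.
Qed.

Lemma count_prime_le m : (0 < m)%N -> (count prime (iota 0 m.*2.+1) <= m)%N.
Proof.
case: m => // m _; elim: m => [//|m IHm].
have -> : iota 0 m.+2.*2.+1 = iota 0 m.+1.*2.+1 ++ [:: m.+1.*2.+1; m.+2.*2].
  by rewrite -(_ : m.+1.*2.+1 + 2 = m.+2.*2.+1)%N ?iotaD ?add0n//; lia.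
rewrite count_cat [X in (_ + X)%N]/=; move: (count _ _) IHm => q IHm.
have -> : prime m.+2.*2 = false.
  apply/negP => /even_prime[|]; first lia.
  by rewrite odd_double.
by case: (prime _); lia.
Qed.

Lemma expn2_ge c : (6 <= c)%N -> (3 * (3 * c + 1) <= 2 ^ c)%N.
Proof.
move=> c6; rewrite -(subnK c6); elim: (c - 6)%N => [//|d IH].
by rewrite addSn expnS; move: (2 ^ _)%N IH => q; lia.
Qed.

(* Among the primes up to [N = 2^k], with [N] about [P^(3/2)], those below [P] are
   negligible by the trivial count, so a lower Chebyshev bound suffices. *)
Lemma many_primes P : (4096 <= P)%N -> exists2 N, (P <= N)%N &
  (N ^ 2 <= count prime (iota P.+1 (N - P)) * P ^ 2)%N.
Proof.
move=> P4096; have P0 : (0 < P)%N by lia.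
set j := trunc_log 2 P; have jP : (2 ^ j <= P)%N by exact: trunc_logP.
have Pj : (P < 2 ^ j.+1)%N by exact: trunc_log_ltn.
have j12 : (12 <= j)%N by exact: trunc_log_max.
set c := j./2; have jc : (j <= c.*2.+1)%N /\ (c.*2 <= j)%N.
  by have := odd_double_half j; rewrite -/c; case: odd; lia.
case: jc => jc cj.
have c6 : (6 <= c)%N by lia.
have PN : (P <= 2 ^ (j + c))%N.
  by rewrite (leq_trans (ltnW Pj))// leq_exp2l//; lia.
exists (2 ^ (j + c))%N => //.
set s := count _ _.
have sE : (count prime (iota 0 (2 ^ (j + c)).+1) = count prime (iota 0 P.+1) + s)%N.
  rewrite -count_cat -[X in iota X _]add0n -[in iota P.+1 _](add0n P.+1) -iotaD.
  by congr (count _ (iota _ _)); lia.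
have hP : (count prime (iota 0 P.+1) <= 2 ^ j)%N.
  have := @count_prime_le (2 ^ j); rewrite expn_gt0 => /(_ isT); apply: leq_trans.
  rewrite -mul2n -expnS -(subnKC (ltnW Pj)) -addSn iotaD count_cat; exact: leq_addr.
have := @pow2_le_count_prime (j + c); rewrite addn_gt0 orbC (ltn_trans _ c6)// => /(_ isT).
rewrite sE => h.
have h3 := expn2_ge c6.
(* At least 3 * 2^j - 1 primes are at most N = 2^(j + c), and at most 2^j of them are at most [P],
   so s >= 2^j >= 4^c. *)
have cs : (4 ^ c <= s)%N.
  have c4 : (4 ^ c <= 2 ^ j)%N by rewrite -(expnM 2 2) leq_exp2l// mul2n.
  have : (3 * (j + c) * 2 ^ j <= (j + c) * (count prime (iota 0 P.+1) + s).+1)%N.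
    apply: leq_trans h; rewrite expnD [leqRHS]mulnC leq_mul2r; apply/orP; right.
    by apply: leq_trans h3; rewrite leq_mul2l/=; lia.
  rewrite [X in (X * _ <= _)%N]mulnC -mulnA leq_mul2l => /orP[|]; first lia.
  have : (0 < 2 ^ j)%N by rewrite expn_gt0.
  lia.
apply: leq_trans (leq_mul cs (leqnn _)).
apply: (@leq_trans (4 ^ c * (2 ^ j) ^ 2)%N); last by rewrite leq_mul2l leq_sqr jP orbT.
have -> : (4 ^ c = (2 ^ c) ^ 2)%N by rewrite -expnM mulnC expnM.
by rewrite expnD expnMn mulnC.
Qed.

(** Four primes up to 2P give four terms (P/p)^2 >= 1/4, hence a sum of at least 1. *)
Lemma four_primes P : (15 <= P < 4096)%N ->
  exists s : seq nat, [/\ uniq s, size s = 4 &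
    all (fun p => prime p && (P < p <= P.*2)%N) s].
Proof.
move=> PP.
have quad a b c d : all prime [:: a; b; c; d] ->
    [&& P < a, a < b, b < c, c < d & d <= P.*2]%N ->
    exists s : seq nat, [/\ uniq s, size s = 4 &
      all (fun p => prime p && (P < p <= P.*2)%N) s].
  move=> /and5P[pa pb pc pd _] /and5P[h1 h2 h3 h4 h5]; exists [:: a; b; c; d].
  split => //=; last by rewrite pa pb pc pd; lia.
  by rewrite !inE; lia.
have [?|?] := ltnP P 17; first by apply: (quad 17 19 23 29)%N; [vm_compute|lia].
have [?|?] := ltnP P 19; first by apply: (quad 19 23 29 31)%N; [vm_compute|lia].
have [?|?] := ltnP P 23; first by apply: (quad 23 29 31 37)%N; [vm_compute|lia].
have [?|?] := ltnP P 31; first by apply: (quad 31 37 41 43)%N; [vm_compute|lia].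
have [?|?] := ltnP P 47; first by apply: (quad 47 53 59 61)%N; [vm_compute|lia].
have [?|?] := ltnP P 73; first by apply: (quad 73 79 83 89)%N; [vm_compute|lia].
have [?|?] := ltnP P 127; first by apply: (quad 127 131 137 139)%N; [vm_compute|lia].
have [?|?] := ltnP P 233; first by apply: (quad 233 239 241 251)%N; [vm_compute|lia].
have [?|?] := ltnP P 449; first by apply: (quad 449 457 461 463)%N; [vm_compute|lia].
have [?|?] := ltnP P 877; first by apply: (quad 877 881 883 887)%N; [vm_compute|lia].
have [?|?] := ltnP P 1733; first by apply: (quad 1733 1741 1747 1753)%N; [vm_compute|lia].
have [?|?] := ltnP P 3449; first by apply: (quad 3449 3457 3461 3463)%N; [vm_compute|lia].
by apply: (quad 4099 4111 4127 4129)%N; [vm_compute|lia].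
Qed.

Lemma prime_sum_inv_sqr (F : realFieldType) P : prime P -> (5 <= P)%N ->
  exists s : seq nat, [/\ uniq s, all (fun p => prime p && (P < p)%N) s &
    1 <= \sum_(p <- s) (P%:R / p%:R : F) ^+ 2]%R.
Proof.
move=> pP P5.
(* Every term is at least (P/N)^2, so it is enough to count the primes. *)
have bound N (s : seq nat) : (0 < N)%N -> all (fun p => prime p && (P < p <= N)%N) s ->
    (N ^ 2 <= size s * P ^ 2)%N -> (1 <= \sum_(p <- s) (P%:R / p%:R : F) ^+ 2)%R.
  move=> N0 sN h; apply: (@le_trans _ _ (\sum_(p <- s) (P%:R / N%:R : F) ^+ 2)%R).
    rewrite big_const_seq count_predT iter_addr_0 -[leRHS]mulr_natr expr_div_n mulrAC.
    by rewrite ler_pdivlMr ?exprn_gt0 ?ltr0n// mul1r -!natrX -natrM ler_nat mulnC.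
  rewrite big_seq [leRHS]big_seq; apply: ler_sum => p /(allP sN)/and3P[pp Pp pN].
  rewrite ler_sqr ?nnegrE ?divr_ge0// ler_pM2l ?ltr0n.
    by rewrite lef_pV2 ?posrE ?ltr0n ?ler_nat// prime_gt0.
  exact: prime_gt0.
have [P4096|P4096] := leqP 4096 P.
  have [N PN h] := many_primes P4096.
  exists [seq p <- iota P.+1 (N - P) | prime p]; split.
  - by rewrite filter_uniq// iota_uniq.
  - by apply/allP => p; rewrite mem_filter mem_iota => /andP[-> /andP[->]].
  - apply: (bound N); first lia; last by rewrite size_filter.
    by apply/allP => p; rewrite mem_filter mem_iota => /and3P[-> ->]; lia.
have [P15|P15] := leqP 15 P.
  have [s [us ss h]] := @four_primes P ltac:(lia).
  exists s; split => //; first by apply: sub_all h => p /and3P[-> ->].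
  by apply: (bound P.*2); [lia|exact: h|rewrite ss; lia].
have [->|->|->|->] : [\/ P = 5, P = 7, P = 11 | P = 13]%N.
  have : (P \in [:: 5; 7; 11; 13])%N.
    rewrite !inE; clear bound P4096; do 15 (case: P pP P5 P15 => [//|P pP P5 P15]); lia.
  by rewrite !inE => /or4P[] /eqP ->; [apply: Or41|apply: Or42|apply: Or43|apply: Or44].
- exists [:: 7; 11; 13; 17; 19]%N; split => //.
  by rewrite !big_cons big_nil; lra.
- exists [:: 11; 13; 17; 19; 23]%N; split => //.
  by rewrite !big_cons big_nil; lra.
- exists [:: 13; 17; 19]%N; split => //.
  by rewrite !big_cons big_nil; lra.
- exists [:: 17; 19; 23]%N; split => //.
  by rewrite !big_cons big_nil; lra.
Qed.

Local Open Scope classical_set_scope.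
Local Open Scope ring_scope.

(** * Divisor sums and the Euler product *)

Section DivisorSums.
Variable R : realType.
Implicit Types (r s t : R) (n p : nat).

Lemma natr_powRM (a b : nat) t : (a * b)%:R `^ t = a%:R `^ t * b%:R `^ t :> R.
Proof. by rewrite natrM powRM. Qed.

(** The product map from pairs of divisors to divisors of [m * n] is a bijection, with inverse d ->
    (gcd(d, m), gcd(d, n)). *)
Lemma sigma_coprime t m n : (0 < m)%N -> (0 < n)%N -> coprime m n ->
  sigma t (m * n) = sigma t m * sigma t n.
Proof.
move=> m0 n0 mn; rewrite /sigma mulr_suml.
under [RHS]eq_bigr do rewrite mulr_sumr.
under [RHS]eq_bigr do under eq_bigr do rewrite -natr_powRM.
rewrite -(@big_allpairs _ _ _ _ _ _ _ (fun i => (i.1 * i.2)%:R `^ t)).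
rewrite -(big_map (fun i => (i.1 * i.2)%N) predT (fun d => d%:R `^ t)).
apply/perm_big/uniq_perm; first exact: divisors_uniq.
  rewrite map_inj_in_uniq ?allpairs_uniq ?divisors_uniq//; first by case=> ? ? [].
  move=> [? ?] [? ?] /allpairsP[[a b]/= [am bn [-> ->]]] /allpairsP[[c d]/= [cm dn [-> ->]]]/= e.
  move: am bn cm dn e; rewrite -!dvdn_divisors// => am bn cm dn e.
  have cop x y : (x %| m)%N -> (y %| n)%N -> coprime x y.
    by move=> xm yn; rewrite (coprime_dvdl xm)// (coprime_dvdr yn).
  congr pair; apply/eqP; rewrite eqn_dvd; apply/andP; split.
  - by rewrite -(Gauss_dvdl _ (cop _ _ am dn)) -e dvdn_mulr.
  - by rewrite -(Gauss_dvdl _ (cop _ _ cm bn)) e dvdn_mulr.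
  - by rewrite -(@Gauss_dvdr b c d) -?e ?dvdn_mull// coprime_sym cop.
  - by rewrite -(@Gauss_dvdr d a b) ?e ?dvdn_mull// coprime_sym cop.
move=> d; rewrite -dvdn_divisors ?muln_gt0 ?m0//.
apply/idP/mapP => [dmn|[[? ?] /allpairsP[[a b]/= [am bn [-> ->]]] ->]]; last first.
  by rewrite /= dvdn_mul ?dvdn_divisors.
exists (gcdn d m, gcdn d n).
  by apply/allpairsP; exists (gcdn d m, gcdn d n); rewrite -!dvdn_divisors// !dvdn_gcdr.
apply/eqP; rewrite /= eqn_dvd; apply/andP; split.
  rewrite muln_gcdl !muln_gcdr !dvdn_gcd dmn -andbA.
  by apply/and4P; split; [exact: dvdn_mulr|exact: dvdn_mulr|exact: dvdn_mull|].
rewrite Gauss_dvd ?dvdn_gcdl//.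
by rewrite (coprime_dvdl (dvdn_gcdr _ _))// (coprime_dvdr (dvdn_gcdr _ _)).
Qed.

Lemma sigma_expn t p a : prime p ->
  sigma t (p ^ a) = \sum_(0 <= i < a.+1) (p%:R `^ t) ^+ i.
Proof.
move=> pp; have p0 : (0 < p)%N by exact: prime_gt0.
have e i : (p%:R `^ t) ^+ i = (p ^ i)%N%:R `^ t :> R.
  by elim: i => [|i IH]; rewrite ?expr0 ?expn0 ?powR1// exprS IH expnS natr_powRM.
under eq_bigr do rewrite e.
rewrite /sigma -(big_map (fun i => (p ^ i)%N) predT (fun d => d%:R `^ t)).
apply/perm_big/uniq_perm; first exact: divisors_uniq.
  rewrite map_inj_uniq ?iota_uniq// => i j /eqP; rewrite eqn_exp2l ?prime_gt1// => /eqP//.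
move=> d; rewrite -dvdn_divisors ?expn_gt0 ?p0//; apply/(dvdn_pfactor _ _ pp)/mapP.
  by case=> i ia ->; exists i; rewrite // mem_index_iota ltnS.
by case=> i; rewrite mem_index_iota ltnS => /andP[_ ia] ->; exists i.
Qed.

Definition euler_factor r p : R := (1 - p%:R `^ (- r))^-1.

(** The bound is strict: the factor at a prime [p] first enters in [euler_prod r p.+1]. *)
Definition euler_prod r k : R := \prod_(0 <= p < k | prime p) euler_factor r p.

Lemma natpowN_gt0 r p : (0 < p)%N -> 0 < p%:R `^ (- r) :> R.
Proof. by move=> p0; rewrite powR_gt0// ltr0n. Qed.

Lemma natpowN_lt1 r p : 0 < r -> (1 < p)%N -> p%:R `^ (- r) < 1 :> R.
Proof.
move=> r0 p1; rewrite powRN invf_lt1 ?powR_gt0 ?ltr0n ?(ltnW p1)//.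
have e : 1 `^ r = 1 :> R by rewrite powR1.
by rewrite -[ltLHS]e gt0_ltr_powR ?nnegrE// ltr1n.
Qed.

Lemma euler_factor_ge1 r p : 0 < r -> (1 < p)%N -> 1 <= euler_factor r p.
Proof.
move=> r0 p1; have := natpowN_lt1 r0 p1; have := natpowN_gt0 r (ltnW p1).
by rewrite /euler_factor => h0 h1; rewrite invf_ge1; lra.
Qed.

Lemma euler_prod_gt0 r k : 0 < r -> 0 < euler_prod r k.
Proof.
move=> r0; apply: prodr_gt0 => p pp; apply: lt_le_trans (euler_factor_ge1 r0 _) => //.
exact: prime_gt1.
Qed.

Lemma euler_prodS r k : euler_prod r k.+1 =
  euler_prod r k * (if prime k then euler_factor r k else 1).
Proof. by rewrite /euler_prod big_mkcond big_nat_recr//= -big_mkcond. Qed.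

Lemma sigma_expn_cvg r p : 0 < r -> prime p ->
  sigma (- r) (p ^ a) @[a --> \oo] --> euler_factor r p.
Proof.
move=> r0 pp; have := natpowN_lt1 r0 (prime_gt1 pp).
have := natpowN_gt0 r (prime_gt0 pp) => q0 q1.
have := @cvg_geometric_series R 1 (p%:R `^ (- r)); rewrite gtr0_norm// => /(_ q1).
rewrite mul1r -cvg_shiftS; apply: cvg_trans; apply/near_eq_cvg/nearW => a /=.
by rewrite sigma_expn// seriesEnat/=; apply: eq_bigr => i _; rewrite mul1r.
Qed.

Lemma sigma_expn_le r p a : 0 < r -> prime p ->
  sigma (- r) (p ^ a) <= euler_factor r p.
Proof.
move=> r0 pp; have c := sigma_expn_cvg r0 pp.
rewrite -(cvg_lim (@Rhausdorff R) c).
apply: (@nondecreasing_cvgn_le _ (fun a => sigma (- r) (p ^ a))); last exact: cvgP c.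
apply/nondecreasing_seqP => n; rewrite !sigma_expn// [leRHS]big_nat_recr//= lerDl.
by rewrite exprn_ge0// powR_ge0.
Qed.

Lemma ler_sigma t m (s : seq nat) : (0 < m)%N -> uniq s -> all (dvdn^~ m) s ->
  \sum_(d <- s) d%:R `^ t <= sigma t m.
Proof.
move=> m0 us /allP sm; rewrite /sigma.
rewrite [leRHS](bigID (mem s))/= -[leLHS]addr0; apply: lerD; last first.
  by apply: sumr_ge0 => i _; exact: powR_ge0.
rewrite -[leRHS]big_filter le_eqVlt; apply/orP; left; apply/eqP/perm_big.
rewrite uniq_perm ?filter_uniq ?divisors_uniq// => d.
by rewrite mem_filter -dvdn_divisors//= andb_idr// => /sm.
Qed.

Lemma sigma_ge1 t m : (0 < m)%N -> 1 <= sigma t m.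
Proof.
move=> m0; have := @ler_sigma t m [:: 1%N] m0 isT; rewrite /= dvd1n => /(_ isT).
by rewrite big_seq1 powR1.
Qed.

Lemma sigma1 t : sigma t 1 = 1.
Proof. by rewrite /sigma /divisors/= big_seq1 powR1. Qed.

(** * Convergence of the zeta series *)

Lemma series_riemannRE r N :
  series (riemannR r) N = \sum_(n <- iota 1 N) n%:R `^ (- r).
Proof.
rewrite seriesEnat/= -[in RHS]addn1 addnC iotaDl big_map /index_iota subn0.
by apply: eq_bigr => i _; rewrite /riemannR powRN add1n.
Qed.

Lemma series_riemannRS r N : series (riemannR r) N.+1 =
  series (riemannR r) N + N.+1%:R `^ (- r).
Proof. by rewrite seriesSr /riemannR powRN. Qed.

Lemma natpowN_le r m n : 0 <= r -> (0 < m <= n)%N ->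
  n%:R `^ (- r) <= m%:R `^ (- r) :> R.
Proof.
move=> r0 /andP[m0 mn]; rewrite !powRN lef_pV2 ?posrE ?powR_gt0 ?ltr0n ?(leq_trans m0)//.
by rewrite ge0_ler_powR ?nnegrE ?ler_nat.
Qed.

(** The terms at 2m + 2 and 2m + 3 are each at most (2m + 2)^-r, and twice this is 2^(1-r) (m +
    1)^-r. *)
Lemma series_riemannR_double r m : 0 <= r ->
  series (riemannR r) m.*2.+1 <= 1 + 2 `^ (1 - r) * series (riemannR r) m.
Proof.
move=> r0; elim: m => [|m IHm].
  by rewrite series_riemannRS seriesEnat/= big_geq// powR1 mulr0 addrC.
rewrite doubleS !series_riemannRS mulrDr addrA.
suff : m.*2.+2%:R `^ (- r) + m.*2.+3%:R `^ (- r) <= 2 `^ (1 - r) * m.+1%:R `^ (- r) :> R.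
  by move: IHm; rewrite series_riemannRS; lra.
have -> : 2 `^ (1 - r) * m.+1%:R `^ (- r) = m.*2.+2%:R `^ (- r) + m.*2.+2%:R `^ (- r) :> R.
  rewrite powRD ?pnatr_eq0 ?implybT// powRr1// -mulrA -natr_powRM.
  by rewrite mul2n doubleS mulr_natl mulr2n.
by rewrite lerD2l natpowN_le//= ltnW.
Qed.

Lemma series_riemannR_nd r : {homo series (riemannR r) : m n / (m <= n)%N >-> m <= n}.
Proof.
by apply/nondecreasing_seqP => n; rewrite series_riemannRS lerDl powR_ge0.
Qed.

(* Grouping the terms of index 2m and 2m+1 gives S(2N+1) <= 1 + 2^(1-r) S(N). *)
Lemma series_riemannR_bound r N : 1 < r ->
  series (riemannR r) N <= (1 - 2 `^ (1 - r))^-1.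
Proof.
move=> r1; have c0 : 0 < 2 `^ (1 - r) :> R by rewrite powR_gt0.
have c1 : 2 `^ (1 - r) < 1 :> R.
  rewrite -(opprB r) powRN invf_lt1//.
  have e : 1 `^ (r - 1) = 1 :> R by rewrite powR1.
  by rewrite -[ltLHS]e gt0_ltr_powR ?nnegrE ?subr_gt0// ltr1n.
move: (2 `^ (1 - r)) c0 c1 (@series_riemannR_double r) => c c0 c1 dbl.
have B0 : 0 < (1 - c)^-1 by rewrite invr_gt0 subr_gt0.
have [n] := ubnP N; elim: n N => // n IHn [|N] Nn.
  by rewrite seriesEnat/= big_geq// ltW.
have hN : (N.+1 <= N.+1./2.*2.+1)%N by have := odd_double_half N.+1; case: odd; lia.
apply: le_trans (series_riemannR_nd r hN) _; apply: le_trans (dbl _ _) _; first by lra.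
(* The bound is the fixed point of x -> 1 + c x, which closes the induction. *)
have e : (1 - c)^-1 = 1 + c * (1 - c)^-1 by field; rewrite subr_eq0 gt_eqF.
rewrite e lerD2l ler_pM2l//.
by apply: IHn; have := odd_double_half N.+1; case: odd; lia.
Qed.

Lemma zeta_cvg r : 1 < r -> series (riemannR r) @ \oo --> zeta r.
Proof.
move=> r1; apply: nondecreasing_is_cvgn; first exact: series_riemannR_nd.
by exists (1 - 2 `^ (1 - r))^-1 => _ [n _ <-]; exact: series_riemannR_bound.
Qed.

Lemma series_riemannR_le_zeta r N : 1 < r -> series (riemannR r) N <= zeta r.
Proof.
move=> r1; apply: nondecreasing_cvgn_le; first exact: series_riemannR_nd.
exact: cvgP (zeta_cvg r1).
Qed.

Lemma sigma_le_zeta r n : 1 < r -> (0 < n)%N -> sigma (- r) n <= zeta r.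
Proof.
move=> r1 n0; apply: le_trans (series_riemannR_le_zeta n r1).
rewrite series_riemannRE /sigma [leRHS](bigID (mem (divisors n)))/= -[leLHS]addr0.
apply: lerD; last by apply: sumr_ge0 => i _; exact: powR_ge0.
rewrite -[leRHS]big_filter le_eqVlt; apply/orP; left; apply/eqP/perm_big.
rewrite uniq_perm ?filter_uniq ?iota_uniq ?divisors_uniq// => d.
rewrite mem_filter/= andb_idr// -dvdn_divisors// mem_iota => dn.
by rewrite add1n ltnS (dvdn_leq n0 dn) (dvdn_gt0 n0 dn).
Qed.

(** * Rough and smooth numbers, cut at the same bound as the Euler product *)

Definition rough k n := (0 < n)%N && all (leq k) (primes n).
Definition smooth k n := (0 < n)%N && all (ltn^~ k) (primes n).

Lemma rough_coprime_expn k n a : rough k.+1 n -> prime k -> coprime n (k ^ a).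
Proof.
move=> /andP[n0 /allP h] pk; apply: coprimeXr; rewrite coprime_sym prime_coprime//.
by apply/negP => kn; have := h k; rewrite mem_primes pk n0 kn ltnn => /(_ isT).
Qed.

Lemma rough_mul_expn k n a : rough k.+1 n -> prime k -> rough k (n * k ^ a).
Proof.
move=> /andP[n0 /allP h] pk; rewrite /rough muln_gt0 n0 expn_gt0 prime_gt0//=.
apply/allP => p; rewrite primesM ?expn_gt0 ?(prime_gt0 pk)// => /orP[/h /ltnW//|].
case: a => [|a]; first by rewrite expn0.
by rewrite primesX// primes_prime// inE => /eqP ->.
Qed.

(** Multiplying [n] by [k ^ a] for a prime [k] and letting [a] grow trades one Euler factor for
    roughness at a smaller bound; at [k = 0] no factor is left. *)
Lemma sigma_rough_le r k n : 1 < r -> rough k n ->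
  sigma (- r) n * euler_prod r k <= zeta r.
Proof.
move=> r1; elim: k n => [|k IHk] n nk.
  rewrite /euler_prod big_geq// mulr1; apply: sigma_le_zeta => //.
  by case/andP: nk.
rewrite euler_prodS; case: ifPn => pk; last first.
  rewrite mulr1; apply: IHk; case/andP: nk => n0 h; rewrite /rough n0/=.
  by apply: sub_all h => p /ltnW.
have n0 : (0 < n)%N by case/andP: nk.
have r0 : 0 < r by lra.
have c : sigma (- r) n * euler_prod r k * sigma (- r) (k ^ a) @[a --> \oo]
    --> sigma (- r) n * euler_prod r k * euler_factor r k.
  by apply: cvgMl_tmp; exact: sigma_expn_cvg.
rewrite mulrA; apply: (cvgr_to_le c).
apply: nearW => a; rewrite mulrAC -sigma_coprime ?expn_gt0 ?(prime_gt0 pk)//; last first.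
  exact: rough_coprime_expn.
by apply: IHk; exact: rough_mul_expn.
Qed.

(** Splitting off the power of each prime in turn costs at most its Euler factor. *)
Lemma sigma_smooth_le r k n : 0 < r -> smooth k n -> sigma (- r) n <= euler_prod r k.
Proof.
move=> r0; elim: k n => [|k IHk] n /andP[n0 /allP nk].
  have : primes n == [::] by case: (primes n) nk => // p s /(_ p); rewrite mem_head => /(_ isT).
  rewrite primes_eq0 => n2; have -> : n = 1%N by lia.
  by rewrite sigma1 /euler_prod big_geq.
rewrite euler_prodS; case: ifPn => pk.
  have [m km nE] := pfactor_coprime pk n0.
  have m0 : (0 < m)%N by move: n0; rewrite nE muln_gt0 => /andP[].
  rewrite nE sigma_coprime ?expn_gt0 ?(prime_gt0 pk)//; last first.
    by rewrite coprime_sym coprimeXl.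
  rewrite ler_pM ?sigma_expn_le// ?(le_trans ler01 (sigma_ge1 _ _)) ?expn_gt0 ?(prime_gt0 pk)//.
  apply: IHk; rewrite /smooth m0/=; apply/allP => p pm; rewrite ltn_neqAle.
  have -> : (p <= k)%N.
    by apply: nk; rewrite nE primesM ?pm// expn_gt0 prime_gt0.
  rewrite andbT; apply: contraTneq km => pk'; rewrite prime_coprime// -pk'.
  by move: pm; rewrite mem_primes => /and3P[_ _ ->].
rewrite mulr1; apply: IHk; rewrite /smooth n0/=; apply/allP => p pn.
rewrite ltn_neqAle -ltnS (nk _ pn : (p < k.+1)%N) andbT; apply: contraNneq pk => <-.
by move: pn; rewrite mem_primes => /andP[].
Qed.

Lemma prime_dvd_fact_le p m : prime p -> (p %| m`!)%N -> (p <= m)%N.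
Proof.
move=> pp; elim: m => [|m IHm]; first by rewrite fact0 dvdn1 => /eqP p1; rewrite p1 in pp.
rewrite factS Euclid_dvdM// => /orP[/dvdn_leq|/IHm /leqW//]; exact.
Qed.

Lemma series_riemannR_le_sigma r N : series (riemannR r) N <= sigma (- r) N`!.
Proof.
rewrite series_riemannRE ler_sigma ?fact_gt0 ?iota_uniq//.
by apply/allP => d; rewrite mem_iota add1n ltnS => /dvdn_fact.
Qed.

Lemma zeta_approx r x : 1 < r -> x < zeta r -> exists N, x < sigma (- r) N`!.
Proof.
move=> r1 xz; have := zeta_cvg r1 => /cvgrPdist_lt /(_ (zeta r - x)).
rewrite subr_gt0 => /(_ xz)[N _ /(_ N (leqnn N))/= h]; exists N.
apply: lt_le_trans (series_riemannR_le_sigma _ _).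
by move: h; rewrite ger0_norm ?subr_ge0 ?series_riemannR_le_zeta//; lra.
Qed.

(** The number N! is divisible by 1, ..., N and has no prime factor above N. With [sigma_rough_le]
    at [n = 1], this is Euler's product formula. *)
Lemma euler_prod_approx r x : 1 < r -> x < zeta r -> exists k, x < euler_prod r k.
Proof.
move=> r1 /(zeta_approx r1)[N h]; exists N.+1; apply: lt_le_trans h _.
rewrite sigma_smooth_le//; first by lra.
rewrite /smooth fact_gt0; apply/allP => p.
by rewrite mem_primes => /and3P[pp _]; exact: prime_dvd_fact_le.
Qed.

(** The ratio of consecutive values is largest at [a = 0], which is why [tail_cond] involves only 1
    + p^-r. *)
Lemma sigma_expnS t p a : prime p ->
  sigma t (p ^ a.+1) <= sigma t (p ^ a) * (1 + p%:R `^ t).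
Proof.
move=> pp; rewrite mulrDr mulr1 [leLHS]sigma_expn// big_nat_recr//= -sigma_expn//.
rewrite lerD2l exprSr ler_wpM2r ?powR_ge0// sigma_expn// big_nat_recr//= lerDr.
by apply: sumr_ge0 => i _; rewrite exprn_ge0 ?powR_ge0.
Qed.

Lemma smooth_mul_expn k n a : smooth k n -> prime k -> smooth k.+1 (n * k ^ a).
Proof.
move=> /andP[n0 /allP h] pk; rewrite /smooth muln_gt0 n0 expn_gt0 prime_gt0//=.
apply/allP => p; rewrite primesM ?expn_gt0 ?(prime_gt0 pk)// => /orP[/h/= /ltnW//|].
case: a => [|a]; first by rewrite expn0.
by rewrite primesX// primes_prime// inE => /eqP ->.
Qed.

Lemma smooth_coprime_expn k n a : smooth k n -> prime k -> coprime n (k ^ a).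
Proof.
move=> /andP[n0 /allP h] pk; apply: coprimeXr; rewrite coprime_sym prime_coprime//.
by apply/negP => kn; have := h k; rewrite mem_primes pk n0 kn /= ltnn => /(_ isT).
Qed.

(* With T the product of the Euler factors over the primes above [p], this is
   1 + p^-r <= T, written without the quotient T = zeta r / euler_prod r p.+1. *)
Definition tail_cond r p := (1 + p%:R `^ (- r)) * euler_prod r p.+1 <= zeta r.

(* The second bound says that [x / sigma (- r) n] is still below the part of the
   Euler product over the primes not yet used; [tail_cond] is what lets one
   pass from exponent [b.+1], which overshoots [x], back to [b]. *)
Lemma greedy r x k : 1 < r ->
  (forall p, prime p -> tail_cond r p) ->
  1 <= x < zeta r ->
  exists2 n, smooth k n & sigma (- r) n <= x /\ x * euler_prod r k < sigma (- r) n * zeta r.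
Proof.
move=> r1 cond /andP[x1 xz]; have r0 : 0 < r by lra.
elim: k => [|k [n nk [nx xn]]].
  by exists 1%N => //; rewrite sigma1 /euler_prod big_geq// mulr1 mul1r.
have nk' a pk := @smooth_coprime_expn k n a nk pk.
have n0 : (0 < n)%N by case/andP: nk.
have [pk|pk] := boolP (prime k); last first.
  exists n; last by rewrite euler_prodS (negPf pk) mulr1.
  case/andP: nk => n0' /allP h; rewrite /smooth n0/=; apply/allP => p /h/= /ltnW.
  by [].
have sE a : sigma (- r) (n * k ^ a) = sigma (- r) n * sigma (- r) (k ^ a).
  by rewrite sigma_coprime ?expn_gt0 ?(prime_gt0 pk)// nk'.
have s0 m : (0 < m)%N -> 0 < sigma (- r) m by move=> m0; exact: lt_le_trans (sigma_ge1 _ m0).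
have h0 : 0 < euler_factor r k by apply: lt_le_trans (euler_factor_ge1 r0 (prime_gt1 pk)).
(* If some power of [k] overshoots [x], the exponent chosen is the one just before the first
   overshoot; exponent 0 never overshoots. *)
have [[a xa]|nex] := pselect (exists a, x < sigma (- r) (n * k ^ a)).
  have ex : exists a, x < sigma (- r) (n * k ^ a) by exists a.
  case: (ex_minnP ex) => -[|b] {a xa ex} xb minb.
    by move: xb; rewrite expn0 muln1; lra.
  exists (n * k ^ b)%N; first exact: smooth_mul_expn.
  split; first by rewrite leNgt; apply/negP => /minb; rewrite ltnn.
  apply: lt_le_trans (_ : sigma (- r) (n * k ^ b.+1) * euler_prod r k.+1 <= _).
    by rewrite ltr_pM2r ?euler_prod_gt0.
  rewrite !sE -!mulrA ler_pM2l ?s0//.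
  apply: le_trans (_ : sigma (- r) (k ^ b) * (1 + k%:R `^ (- r)) * euler_prod r k.+1 <= _).
    by rewrite ler_pM2r ?euler_prod_gt0// sigma_expnS.
  rewrite -mulrA ler_pM2l ?s0 ?expn_gt0 ?(prime_gt0 pk)//.
  exact: cond.
(* Otherwise every exponent stays below [x], and the strict inequality, valid in the limit, holds
   for some finite exponent. *)
have c : sigma (- r) n * sigma (- r) (k ^ a) * zeta r @[a --> \oo]
    --> sigma (- r) n * euler_factor r k * zeta r.
  by apply: cvgMr_tmp; apply: cvgMl_tmp; exact: sigma_expn_cvg.
have : x * euler_prod r k.+1 < sigma (- r) n * euler_factor r k * zeta r.
  by rewrite euler_prodS pk [ltRHS]mulrAC mulrA ltr_pM2r.
move=> /(cvgr_gt _ c)[a _ /(_ a (leqnn a))/= ha].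
exists (n * k ^ a)%N; first exact: smooth_mul_expn.
split; last by rewrite sE.
by rewrite leNgt; apply/negP => xa; apply: nex; exists a.
Qed.

Lemma sigma_range_dense r : 1 < r ->
  (forall p, prime p -> tail_cond r p) ->
  dense_in (sigma_range (- r)) (`[1, zeta r[ : set R).
Proof.
move=> r1 cond x /=; rewrite in_itv/= => /[dup] x1z /andP[x1 xz] B.
rewrite -nbhs_ballE => -[e /= e0 eB].
have [k hk] : exists k, zeta r - e < euler_prod r k.
  by apply: euler_prod_approx => //; lra.
have [n /andP[n0 _] [nx xn]] := greedy k r1 cond x1z.
exists (sigma (- r) n); split; first by exists n.
apply: eB; rewrite /ball/= ger0_norm ?subr_ge0//.
have z0 : 0 < zeta r by lra.
(* By the greedy bound, zeta r (x - sigma n) < x (zeta r - E) <= zeta r (zeta r - E), where E is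
   [euler_prod r k]. *)
rewrite -(ltr_pM2l z0); apply: (@lt_le_trans _ _ (zeta r * (zeta r - euler_prod r k))).
  apply: (@lt_le_trans _ _ (x * (zeta r - euler_prod r k))).
    by rewrite !mulrBr (mulrC (zeta r)) [X in _ - X < _]mulrC; lra.
  rewrite ler_wpM2r ?(ltW xz)// subr_ge0.
  have := @sigma_rough_le r k 1%N r1; rewrite sigma1 mul1r; exact.
by rewrite ler_wpM2l ?(ltW z0)//; lra.
Qed.

(* If [tail_cond r p] fails, no value of [sigma (- r)] lies strictly between
   [zeta r / euler_prod r p.+1] and [1 + p^-r]: it is below the former when all
   prime factors exceed [p], and above the latter otherwise. *)
Lemma sigma_range_dense_cond r p : 1 < r -> prime p ->
  dense_in (sigma_range (- r)) (`[1, zeta r[ : set R) ->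
  tail_cond r p.
Proof.
move=> r1 pp dns; rewrite /tail_cond leNgt; apply/negP => gap.
have r0 : 0 < r by lra.
have H0 := euler_prod_gt0 p.+1 r0.
set a := zeta r / euler_prod r p.+1; set b := 1 + p%:R `^ (- r).
have ab : a < b by rewrite ltr_pdivrMr.
have a1 : 1 <= a.
  rewrite ler_pdivlMr//.
  by have := @sigma_rough_le r p.+1 1%N r1; rewrite sigma1; exact.
(* With [a1], this puts the gap inside [1, zeta r), where density applies. *)
have bz : b <= zeta r.
  apply: le_trans (sigma_le_zeta r1 (prime_gt0 pp)).
  have := @ler_sigma (- r) p [:: 1%N; p] (prime_gt0 pp).
  rewrite /= inE eq_sym neq_ltn (prime_gt1 pp) orbT dvd1n dvdnn => /(_ isT isT).
  by rewrite big_cons big_seq1 powR1.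
pose x := (a + b) / 2.
have xab : a < x < b by rewrite /x; apply/andP; split; lra.
have /dns : (`[1, zeta r[%classic : set R) x by rewrite /= in_itv/=; move: xab; lra.
move=> /(_ `]a, b[%classic) []; first exact: near_in_itvoo.
move=> _ [[n/= n0 <-]]; rewrite /= in_itv/= => /andP[an nb].
have [nr|] := boolP (rough p.+1 n).
  by have := sigma_rough_le r1 nr; rewrite -ler_pdivlMr// -/a; lra.
rewrite /rough n0/= => /allPn[q]; rewrite mem_primes -leqNgt => /and3P[pq _ qn] qp.
have := @ler_sigma (- r) n [:: 1%N; q] n0.
rewrite /= inE eq_sym neq_ltn (prime_gt1 pq) orbT dvd1n qn => /(_ isT isT).
rewrite big_cons big_seq1 powR1.
have := @natpowN_le r q p (ltW r0); rewrite (prime_gt0 pq) qp => /(_ isT).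
by rewrite /b in nb; lra.
Qed.

(** * The inequality at each prime *)

Lemma prime_dvd_prod_mem (s : seq nat) p : prime p -> all prime s ->
  (p %| \prod_(q <- s) q)%N -> p \in s.
Proof.
move=> pp; elim: s => [|q s IH] /=; first by rewrite big_nil Euclid_dvd1.
move=> /andP[pq ps]; rewrite big_cons Euclid_dvdM// inE => /orP[|/IH-> //].
  by rewrite dvdn_prime2// => ->.
by rewrite orbT.
Qed.

(** The product of the primes in [s] has only prime factors above [p], and its divisors include 1
    and every [q] in [s], so [sigma_rough_le] applies to it. *)
Lemma tail_cond_of_primes r p (s : seq nat) : 1 < r -> (0 < p)%N -> uniq s ->
  all (fun q => prime q && (p < q)%N) s ->
  1 <= \sum_(q <- s) (p%:R / q%:R) `^ r -> tail_cond r p.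
Proof.
move=> r1 p0 us /allP sp sum1.
have ps : all prime s by apply/allP => q /sp/andP[].
have n0 : (0 < \prod_(q <- s) q)%N.
  by rewrite big_seq prodn_cond_gt0// => q /sp/andP[/prime_gt0].
have rn : rough p.+1 (\prod_(q <- s) q).
  rewrite /rough n0; apply/allP => q; rewrite mem_primes => /and3P[pq _ qn].
  by have /sp/andP[] := prime_dvd_prod_mem pq ps qn.
apply: le_trans (sigma_rough_le r1 rn); rewrite ler_pM2r ?euler_prod_gt0//; last by lra.
apply: le_trans (_ : \sum_(d <- 1%N :: s) d%:R `^ (- r) <= _); last first.
  apply: ler_sigma => //=; first by rewrite us andbT; apply/negP => /sp/andP[].
  by rewrite dvd1n; apply/allP => q qs; rewrite (big_rem _ qs) dvdn_mulr.
rewrite big_cons powR1 lerD2l.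
have -> : \sum_(q <- s) q%:R `^ (- r) = p%:R `^ (- r) * \sum_(q <- s) (p%:R / q%:R) `^ r :> R.
  rewrite mulr_sumr big_seq [RHS]big_seq; apply: eq_bigr => q /sp/andP[pq _].
  rewrite powRM ?invr_ge0// mulrA -powRD ?pnatr_eq0 ?gtn_eqF ?implybT// addNr powRr0 mul1r.
  by rewrite -powR_inv1// -powRrM mulN1r.
by rewrite ler_peMr// powR_ge0.
Qed.

(** For [p < q] and [r <= 2], (p/q)^r >= (p/q)^2, so one list of primes serves every exponent. *)
Lemma tail_cond_ge5 r p : 1 < r <= 2 -> prime p -> (5 <= p)%N -> tail_cond r p.
Proof.
move=> /andP[r1 r2] pp p5; have [s [us sp sum1]] := @prime_sum_inv_sqr R p pp p5.
apply: (tail_cond_of_primes r1 (prime_gt0 pp) us sp); apply: le_trans sum1 _.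
rewrite big_seq [leRHS]big_seq; apply: ler_sum => q /(allP sp)/andP[_ pq].
rewrite -powR_mulrn ?divr_ge0// ger_powR//.
have q0 : (0 < q)%N by exact: leq_ltn_trans pq.
rewrite divr_gt0 ?ltr0n ?(prime_gt0 pp)//= ler_pdivrMr ?ltr0n// mul1r ler_nat.
exact: ltnW.
Qed.

Lemma euler_prod3 r : euler_prod r 3 = euler_factor r 2.
Proof. by rewrite !euler_prodS /= /euler_prod big_geq// !mul1r. Qed.

Lemma euler_prod4 r : euler_prod r 4 = euler_factor r 2 * euler_factor r 3.
Proof. by rewrite euler_prodS euler_prod3. Qed.

(* At [r = 2] the inequality [1 <= 2 (2/3)^r + 3^-r] used here is an equality. *)
Lemma tail_cond2 r : 1 < r <= 2 -> tail_cond r 3 -> tail_cond r 2.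
Proof.
move=> /andP[r1 r2]; rewrite /tail_cond euler_prod4 euler_prod3; apply: le_trans.
rewrite mulrCA mulrC ler_pM2l; last first.
  by apply: lt_le_trans (euler_factor_ge1 _ _) => //; lra.
have b1 : 3 `^ (- r) < 1 :> R by apply: natpowN_lt1 => //; lra.
(* With a = 2^-r and b = 3^-r, the goal (1 + a)(1 - b) <= 1 + b amounts to a <= 2b + ab. *)
rewrite /euler_factor ler_pdivlMr ?subr_gt0//.
have h1 : 3 `^ (- 2) <= 3 `^ (- r) :> R by apply: ler_powR; lra.
have h2 : (2 / 3) `^ 2 <= (2 / 3) `^ r :> R by apply: ger_powR; lra.
rewrite (@powR_invn R 3 2)// in h1.
have e : (2 / 3) `^ r = 2 `^ r * 3 `^ (- r) :> R.
  by rewrite powRM ?invr_ge0// -[3^-1]powR_inv1// -powRrM mulN1r.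
rewrite (@powR_mulrn R (2 / 3) 2) ?divr_ge0// e in h2.
have a0 : 0 < 2 `^ (- r) :> R by rewrite powR_gt0.
have a1 : 2 `^ (- r) * 2 `^ r = 1 :> R by rewrite -powRD ?addNr ?powRr0// pnatr_eq0 implybT.
have := ler_wpM2l (ltW a0) h2; rewrite [leRHS]mulrA a1 mul1r.
have := ler_wpM2l (ltW a0) h1.
move: (2 `^ (- r)) (3 `^ (- r)) a0 => a b a0; nra.
Qed.

Lemma natpowN_continuous n : continuous (fun r : R => n.+1%:R `^ (- r)).
Proof.
move=> r; rewrite /powR pnatr_eq0/=.
apply: continuous_comp; last exact: continuous_expR.
by apply: cvgMr_tmp; exact: cvgN.
Qed.

(** This exhibits the equation for eta as the case of equality in [tail_cond r 3]. *)
Lemma eta_equationE r : 0 < r ->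
  eta_equation r <-> (1 + 3 `^ (- r)) * euler_prod r 4 = zeta r.
Proof.
move=> r0; rewrite /eta_equation euler_prod4 /euler_factor !powRN.
have gt1 n : (1 < n)%N -> 1 < n%:R `^ r :> R.
  move=> n1; have p0 : 0 < n%:R `^ r :> R by rewrite powR_gt0 ?ltr0n ?(ltnW n1).
  by have := natpowN_lt1 r0 n1; rewrite powRN invf_lt1.
have /gt1 h2 : (1 < 2)%N by []. have /gt1 h3 : (1 < 3)%N by [].
suff -> : (2 `^ r / (2 `^ r - 1)) * ((3 `^ r + 1) / (3 `^ r - 1)) =
  (1 + (3 `^ r)^-1) * ((1 - (2 `^ r)^-1)^-1 * (1 - (3 `^ r)^-1)^-1) :> R by [].
move: (2 `^ r) (3 `^ r) h2 h3 => a b h2 h3.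
by field; repeat (apply/andP; split); lra.
Qed.

(** The witness is the part of [n] built from primes at least [k]; the complementary part is
    smooth. *)
Lemma sigma_le_rough k n : (0 < n)%N ->
  exists2 m, rough k m & forall s, 0 < s ->
    sigma (- s) n <= euler_prod s k * sigma (- s) m.
Proof.
move=> n0; pose pi := [pred p | (p < k)%N].
exists (n`_pi^')%N.
  rewrite /rough part_gt0; apply/allP => p; rewrite primes_part mem_filter => /andP[].
  by rewrite !inE -leqNgt.
move=> s s0; rewrite -{1}(partnC pi n0) sigma_coprime ?part_gt0 ?coprime_partC//.
rewrite ler_wpM2r ?(le_trans ler01 (sigma_ge1 _ _)) ?part_gt0//.
apply: sigma_smooth_le => //; rewrite /smooth part_gt0; apply/allP => p.
by rewrite primes_part mem_filter => /andP[].
Qed.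

Lemma rough4_dvd_ge5 n d : rough 4 n -> (d %| n)%N -> d != 1 -> (5 <= d)%N.
Proof.
move=> /andP[n0 /allP h] dn d1; have d0 := dvdn_gt0 n0 dn.
have d2 : (1 < d)%N by lia.
have pp := pdiv_prime d2; have := h (pdiv d).
rewrite mem_primes pp n0 (dvdn_trans (pdiv_dvd d) dn) => /(_ isT) p4.
apply: leq_trans (pdiv_leq d0); rewrite ltn_neqAle p4 andbT.
by apply/eqP => e; rewrite -e in pp.
Qed.

(** Each side is a sum of powers of 3/d over divisors d >= 5, so raising the exponent shrinks every
    term by at least the same factor. Its uniformity in [n] keeps strictness in the supremum. *)
Lemma sigma_rough4_antitone r s n : r < s -> rough 4 n ->
  3 `^ s * (sigma (- s) n - 1) <= (3 / 5) `^ (s - r) * (3 `^ r * (sigma (- r) n - 1)).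
Proof.
move=> rs rn; have n0 : (0 < n)%N by case/andP: rn.
have sE t : 3 `^ t * (sigma (- t) n - 1) =
    \sum_(d <- divisors n | d != 1%N) (3 / d%:R) `^ t :> R.
  rewrite /sigma (bigD1_seq 1%N) ?divisor1 ?divisors_uniq//= powR1.
  rewrite [X in _ * X]addrAC subrr add0r mulr_sumr.
  apply: eq_bigr => d _; rewrite powRM ?invr_ge0//; congr (_ * _).
  by rewrite -powR_inv1// -powRrM mulN1r.
rewrite !sE mulr_sumr big_seq_cond [leRHS]big_seq_cond; apply: ler_sum => d.
rewrite -dvdn_divisors// => /andP[dn d1].
have d5 := rough4_dvd_ge5 rn dn d1.
have q0 : 0 < 3 / d%:R :> R by rewrite divr_gt0// ltr0n; lia.
have -> : (3 / d%:R) `^ s = (3 / d%:R) `^ (s - r) * (3 / d%:R) `^ r :> R.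
  by rewrite -powRD ?subrK// (gt_eqF q0) implybT.
rewrite ler_wpM2r ?powR_ge0// ge0_ler_powR ?nnegrE ?(ltW q0) ?divr_ge0//; first by lra.
by rewrite ler_pM2l// lef_pV2 ?posrE ?ltr0n ?ler_nat//; lia.
Qed.

(* With W r = zeta r / euler_prod r 4, the supremum of [sigma (- r)] over integers
   coprime to 6, the claim is that 3^r (W r - 1), a sum of (3/d)^r over some
   d >= 5, is strictly decreasing. *)
Lemma tail_cond3_mono r s : 1 < r -> r < s -> tail_cond s 3 ->
  (1 + 3 `^ (- r)) * euler_prod r 4 < zeta r.
Proof.
move=> r1 rs; rewrite /tail_cond => conds; rewrite ltNge; apply/negP => condr.
have r0 : 0 < r by lra. have s0 : 0 < s by lra. have s1 : 1 < s by lra.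
set c : R := (3 / 5) `^ (s - r).
have c0 : 0 <= c by exact: powR_ge0.
have c1 : c < 1.
  have e : 1 `^ (s - r) = 1 :> R by rewrite powR1.
  by rewrite /c -[ltRHS]e gt0_ltr_powR ?nnegrE; lra.
have inv3 t : 3 `^ t * 3 `^ (- t) = 1 :> R.
  by rewrite -powRD ?subrr ?powRr0// pnatr_eq0 implybT.
(* The negated goal bounds 3^r (sigma_{-r}(m) - 1) by 1; passing to [s] gains the factor [c < 1]. *)
have bnd m : rough 4 m -> sigma (- s) m <= 1 + c * 3 `^ (- s).
  move=> rm; have h := sigma_rough4_antitone rs rm.
  have hr : 3 `^ r * (sigma (- r) m - 1) <= 1.
    rewrite -[leRHS](inv3 r) ler_pM2l ?powR_gt0// lerBlDl.
    rewrite -(ler_pM2r (euler_prod_gt0 4 r0)).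
    exact: le_trans (sigma_rough_le r1 rm) condr.
  rewrite -lerBlDl -(@ler_pM2l _ (3 `^ s)) ?powR_gt0// mulrCA inv3.
  by apply: le_trans h _; rewrite ler_wpM2l.
(* Hence some factorial has a value above the left-hand side, and its rough part contradicts
   [bnd]. *)
have : euler_prod s 4 * (1 + c * 3 `^ (- s)) < zeta s.
  apply: lt_le_trans conds; rewrite mulrC ltr_pM2r ?euler_prod_gt0// ltrD2l.
  by rewrite gtr_pMl// powR_gt0.
move=> /(zeta_approx s1)[N hN].
have [m rm /(_ s s0) hm] := sigma_le_rough 4 (fact_gt0 N).
have := lt_le_trans hN hm; rewrite ltr_pM2l ?euler_prod_gt0//.
by rewrite ltNge bnd.
Qed.

(** * Continuity of zeta *)

Lemma series_continuous N : continuous (fun r => series (@riemannR R r) N).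
Proof.
elim: N => [|N IHN] r.
  rewrite (_ : (fun r => _) = cst 0); first exact: cvg_cst.
  by apply/funext => x; rewrite seriesEnat/= big_geq.
rewrite (_ : (fun r => _) = (fun r => series (riemannR r) N) \+ (fun r => N.+1%:R `^ (- r))).
  by apply: cvgD; [exact: IHN|exact: natpowN_continuous].
by apply/funext => x; rewrite series_riemannRS.
Qed.

(** Termwise comparison makes the tails uniformly small for exponents at least [b]. *)
Lemma zeta_tail_le b r N : 1 < b -> b <= r ->
  zeta r - series (riemannR r) N <= zeta b - series (riemannR b) N.
Proof.
move=> b1 br; rewrite lerBlDr; have r1 : 1 < r by lra.
apply: (cvgr_to_le (zeta_cvg r1)); exists N => // M /= NM.
have nd : {homo (fun K => series (riemannR b) K - series (riemannR r) K) :
    m n / (m <= n)%N >-> m <= n}.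
  apply/nondecreasing_seqP => n; rewrite !series_riemannRS.
  suff : n.+1%:R `^ (- r) <= n.+1%:R `^ (- b) :> R by lra.
  by apply: ler_powR; [rewrite ler1n|lra].
by have /= := nd _ _ NM; have := series_riemannR_le_zeta M b1; lra.
Qed.

Lemma zeta_continuous r : 1 < r -> {for r, continuous (@zeta R)}.
Proof.
move=> r1; apply/cvgrPdist_lt => e e0.
pose b := (1 + r) / 2; have b1 : 1 < b by rewrite /b; lra.
have br : b < r by rewrite /b; lra.
have [N hN] : exists N, zeta b - series (riemannR b) N < e / 3.
  have e3 : 0 < e / 3 by lra.
  have := zeta_cvg b1 => /cvgrPdist_lt /(_ _ e3)[N _ /(_ N (leqnn N))/= h]; exists N.
  by apply: le_lt_trans h; exact: ler_norm.
have tail t : b <= t -> 0 <= zeta t - series (riemannR t) N < e / 3.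
  move=> bt; rewrite subr_ge0 series_riemannR_le_zeta/=; last by lra.
  exact: le_lt_trans (zeta_tail_le N b1 bt) hN.
have e3 : 0 < e / 3 by lra.
have /cvgrPdist_lt /(_ _ e3) hc := @series_continuous N r.
near=> t.
have bt : b < t by near: t; exact: lt_nbhsr.
have : `|series (riemannR r) N - series (riemannR t) N| < e / 3 by near: t; exact: hc.
have := tail r (ltW br); have := tail t (ltW bt).
move: (series _ N) (series _ N) => A B.
rewrite !ltr_norml; lra.
Unshelve. all: by end_near.
Qed.

(* The tail of the series is telescoped through 1/n^2 <= 1/(n - 1/2) - 1/(n + 1/2). *)
Lemma zeta2_le : zeta 2 <= 5 / 3 :> R.
Proof.
(* Here 33/20 = 1 + 1/4 + 2/5, where 2/5 is the telescoped tail from n = 3, and 2/(2N + 5) is what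
   remains of it from n = N + 3. *)
have bnd N : series (riemannR 2) N.+2 <= 33 / 20 - 2 / (2 * N%:R + 5) :> R.
  elim: N => [|N IHN].
    rewrite !series_riemannRS seriesEnat/= big_geq// powR1.
    by rewrite (@powR_invn R 2 2)// mulr0 !add0r -exprVn expr2/=; lra.
  rewrite series_riemannRS (@powR_invn R _ 2)//.
  apply: le_trans (lerD IHN (lexx _)) _.
  have n0 : 0 <= N%:R :> R by [].
  have -> : N.+3%:R = N%:R + 3 :> R by rewrite -addn3 natrD.
  have -> : N.+1%:R = N%:R + 1 :> R by rewrite -addn1 natrD.
  move: (N%:R) n0 => x x0; rewrite -subr_ge0.
  have -> : 33 / 20 - 2 / (2 * (x + 1) + 5) - (33 / 20 - 2 / (2 * x + 5) + (x + 3) ^- 2) =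
    (((2 * x + 5) * (2 * x + 7))^-1 * (x + 3) ^- 2).
    by field; repeat (apply/andP; split); lra.
  by rewrite mulr_ge0// invr_ge0; nra.
have h : 1 < 2 :> R by lra.
apply: (cvgr_to_le (zeta_cvg h)); exists 2%N => // -[|[|N]] //= _.
apply: le_trans (bnd N) _.
have : 0 <= 2 / (2 * N%:R + 5) :> R by rewrite divr_ge0// addr_ge0// mulr_ge0.
lra.
Qed.

(** As x^(3/2) is x times the square root of x, a rational lower bound for the root suffices. *)
Lemma ler_powR_three_half (x a : R) : 0 <= a -> a ^+ 2 <= x -> x * a <= x `^ (3 / 2).
Proof.
move=> a0 ax; have x0 : 0 <= x by apply: le_trans ax; exact: sqr_ge0.
have -> : 3 / 2 = 1 + 2^-1 :> R by lra.
rewrite powRD; last by apply/implyP => /eqP; lra.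
rewrite powRr1// powR12_sqrt// ler_wpM2l//.
by rewrite -(ger0_norm a0) -sqrtr_sqr ler_wsqrtr.
Qed.

Lemma tail_cond3_three_half : tail_cond (3 / 2) 3.
Proof.
apply: (@tail_cond_of_primes _ 3 [:: 5; 7; 11; 13; 17]%N) => //; first by lra.
(* The decimals approximate the square roots of 3/q from below. *)
have h5 : 3 / 5 * (77 / 100) <= (3 / 5) `^ (3 / 2) :> R by apply: ler_powR_three_half; lra.
have h7 : 3 / 7 * (65 / 100) <= (3 / 7) `^ (3 / 2) :> R by apply: ler_powR_three_half; lra.
have h11 : 3 / 11 * (52 / 100) <= (3 / 11) `^ (3 / 2) :> R by apply: ler_powR_three_half; lra.
have h13 : 3 / 13 * (48 / 100) <= (3 / 13) `^ (3 / 2) :> R by apply: ler_powR_three_half; lra.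
have h17 : 3 / 17 * (42 / 100) <= (3 / 17) `^ (3 / 2) :> R by apply: ler_powR_three_half; lra.
rewrite !big_cons big_nil addr0.
apply: le_trans (lerD h5 (lerD h7 (lerD h11 (lerD h13 h17)))).
lra.
Qed.

Lemma exists_eta : exists2 s : R, 1 < s <= 2 & eta_equation s.
Proof.
(* The Euler factors are spelled out so that continuity can be read off; a zero of [G] solves the
   equation for eta. *)
pose G r := zeta r - (1 + 3 `^ (- r)) * ((1 - 2 `^ (- r))^-1 * (1 - 3 `^ (- r))^-1).
have GE r : G r = zeta r - (1 + 3 `^ (- r)) * euler_prod r 4 by rewrite /G euler_prod4.
have Gc : {within `[3 / 2, 2], continuous G}.
  apply: continuous_in_subspaceT => r; rewrite inE/= in_itv/= => /andP[r32 _].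
  have r1 : 1 < r by lra.
  have c2 : {for r, continuous (fun r : R => 2 `^ (- r))} by exact: (@natpowN_continuous 1).
  have c3 : {for r, continuous (fun r : R => 3 `^ (- r))} by exact: (@natpowN_continuous 2).
  have n2 : 1 - 2 `^ (- r) != 0 :> R.
    by rewrite subr_eq0 gt_eqF// natpowN_lt1//; lra.
  have n3 : 1 - 3 `^ (- r) != 0 :> R.
    by rewrite subr_eq0 gt_eqF// natpowN_lt1//; lra.
  apply: cvgB; first exact: zeta_continuous.
  apply: cvgM; first by apply: cvgD => //; exact: cvg_cst.
  by apply: cvgM; apply: cvgV => //; apply: cvgB => //; exact: cvg_cst.
have G32 : 0 <= G (3 / 2) by rewrite GE subr_ge0; exact: tail_cond3_three_half.
(* The product is exactly 5/3 at 2, the bound of [zeta2_le]. *)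
have G2 : G 2 <= 0.
  rewrite /G (@powR_invn R 2 2)// (@powR_invn R 3 2)// !expr2.
  have -> : (1 + (3 * 3)^-1) * ((1 - (2 * 2)^-1)^-1 * (1 - (3 * 3)^-1)^-1) = 5 / 3 :> R by field.
  by rewrite subr_le0 zeta2_le.
have [c] : exists2 c, c \in `[3 / 2, 2] & G c = 0.
  by apply: IVT => //; [lra|rewrite ge_min G2 orbT le_max G32].
rewrite in_itv/= => /andP[c32 c2] Gc0; exists c; first by apply/andP; split; lra.
by apply/eta_equationE; [lra|apply/esym/eqP; rewrite -subr_eq0 -GE Gc0].
Qed.

End DivisorSums.

Theorem theorem2p3 (R : realType) :
  (exists! eta : R, 1 < eta <= 2 /\ eta_equation eta) /\
  (forall eta : R, 1 < eta <= 2 -> eta_equation eta ->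
    forall r : R, 1 < r ->
      (dense_in (sigma_range (- r)) (`[1, zeta r[) <-> r <= eta)).
Proof.
(* A solution [t] satisfies [tail_cond t 3], so the inequality is strict at every smaller exponent
   above 1, which excludes a second solution. *)
have eqn_lt (s t : R) : 1 < s -> eta_equation s -> s < t -> eta_equation t -> False.
  move=> s1 es st /eta_equationE et; have t0 : 0 < t by lra.
  have ct : tail_cond t 3 by rewrite /tail_cond et.
  have := tail_cond3_mono s1 st ct.
  by move/eta_equationE: es => ->; rewrite ?ltxx//; lra.
split.
  have [eta e12 ee] := exists_eta R; exists eta; split => // t [t12 et].
  case: (ltgtP eta t) => // h; exfalso.
    by apply: (eqn_lt eta t) => //; lra.
  by apply: (eqn_lt t eta) => //; lra.
move=> eta /andP[e1 e2] /eta_equationE ee r r1; have {}ee := ee (lt_trans ltr01 e1).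
have ceta : tail_cond eta 3 by rewrite /tail_cond ee.
split=> [/(sigma_range_dense_cond r1 (isT : prime 3)) cr|re].
  rewrite leNgt; apply/negP => er.
  by have := tail_cond3_mono e1 er cr; rewrite ee ltxx.
have r2 : 1 < r <= 2 by lra.
(* The condition at 3 passes from [eta] down to [r]; it then yields the one at 2, and primes from 5
   on satisfy theirs since [r <= 2]. *)
have c3 : tail_cond r 3.
  move: re; rewrite le_eqVlt => /orP[/eqP -> //|re].
  exact/ltW/(tail_cond3_mono r1 re ceta).
apply: sigma_range_dense => // p pp.
have [p5|] := leqP 5 p; first exact: tail_cond_ge5.
case: p pp => [|[|[|[|[|p]]]]] // _ _; exact: tail_cond2.
Qed.
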